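(* There exists a $C^2$ convex function $f:\mathbb{R}^2\to\mathbb{R}$ with $\min f=0$, whose set of minimizers is compact with nonempty interior, and which does not satisfy the Kurdyka–Łojasiewicz inequality: for each $r>0$ and each $\varphi\in\mathcal{K}(0,r)$, $$\inf\{\|\nabla(\varphi\circ f)(x)\|:x\in[0<f<r]\}=0.$$
   Context: $\mathcal{K}(0,r)$: functions $\varphi\in C([0,r))\cap C^1(0,r)$ with $\varphi(0)=0$ and $\varphi'(s)>0$ for all $s\in(0,r)$. $[0<f<r]=\{x\in\mathbb{R}^2:0<f(x)<r\}$. *)

(* Defs.v *)
From Stdlib Require Import Reals List.
From Coquelicot Require Import Coquelicot.
Open Scope R_scope.

Definition pd1 (g : R * R -> R) (p : R * R) : R :=
  Derive (fun t => g (t, snd p)) (fst p).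
Definition pd2 (g : R * R -> R) (p : R * R) : R :=
  Derive (fun t => g (fst p, t)) (snd p).

Definition C1_2d (g : R * R -> R) : Prop :=
  (forall p, continuous g p) /\
  (forall p, ex_derive (fun t => g (t, snd p)) (fst p) /\
             ex_derive (fun t => g (fst p, t)) (snd p)) /\
  (forall p, continuous (pd1 g) p /\ continuous (pd2 g) p).

Definition C2_2d (g : R * R -> R) : Prop :=
  C1_2d g /\ C1_2d (pd1 g) /\ C1_2d (pd2 g).

Definition convex2 (g : R * R -> R) : Prop :=
  forall (p q : R * R) (t : R), 0 <= t <= 1 ->
    g (t * fst p + (1 - t) * fst q, t * snd p + (1 - t) * snd q)
      <= t * g p + (1 - t) * g q.

Definition grad_norm (g : R * R -> R) (p : R * R) : R :=
  sqrt (pd1 g p ^ 2 + pd2 g p ^ 2).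

Definition compact2 (S : R * R -> Prop) : Prop :=
  forall (I : Type) (U : I -> R * R -> Prop),
    (forall i, open (U i)) ->
    (forall p, S p -> exists i, U i p) ->
    exists l : list I, forall p, S p -> exists i, In i l /\ U i p.

Definition Kclass (r : R) (phi : R -> R) : Prop :=
  (forall s, 0 <= s < r ->
     filterlim phi (within (fun t => 0 <= t < r) (locally s)) (locally (phi s))) /\
  (forall s, 0 < s < r -> ex_derive phi s) /\
  (forall s, 0 < s < r -> continuous (Derive phi) s) /\
  phi 0 = 0 /\
  (forall s, 0 < s < r -> 0 < Derive phi s).

(* Main.v *)
(** The function is [f x = sum_k a_k * max(0, <u_k, x>^2 - c_k^2)^3] with unit
    vectors [u_k], widths [c_k > 1] and weights [a_k] decreasing so fast that just
    above the level reached by [a_(k+1), a_(k+2), ...] the sublevel sets of [f]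
    look like the intersection of the strips [|<u_j, x>| <= c_j], [j <= k].
    The strips come in rounds: round [n] cuts the disc of radius
    [R_n = 1 + 1/(2n)] down to radius [R_(n+1)] in [n + 1] directions that are
    [1/n]-separated, so that no cut reaches the tip [R_n u_k] of a later one.
    Each cut moves the level set by [R_n - R_(n+1) ~ 1/n^2], hence round [n]
    contributes [~ 1/n] to the total displacement, which is infinite although the
    radii stay bounded. Since [<x, grad f x> >= |grad f x| / 2],
    a desingularising [phi] with [|grad (phi o f)| >= c] would have to
    grow along each of these displacements by at least [c] times its length, up to
    a constant factor, and the intervals of values of [f] involved are disjoint. *)

Require Import Defs.
From Stdlib Require Import Reals List Lra Lia Psatz.
From Stdlib Require Import Classical ClassicalEpsilon FunctionalExtensionality.
From Coquelicot Require Import Coquelicot.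
Open Scope R_scope.

(** * Cutting directions and radii *)

(* [slot k] is (round, index in the round); round [n >= 1] has indices [0..n]. *)
Fixpoint slot (k : nat) : nat * nat :=
  match k with
  | O => (1, 0)%nat
  | S k => let (n, i) := slot k in
           if (i <? n)%nat then (n, S i) else (S n, O)
  end.

Definition round (k : nat) : nat := fst (slot k).

(** Rounds [1] to [n - 1] have sizes [2, ..., n], so round [n] starts at index [n (n + 1) / 2 - 1];
    the last equation is this count cleared of denominators. *)
Lemma slot_spec (k : nat) :
  (snd (slot k) <= round k /\ 1 <= round k /\
   round k * (round k + 1) + 2 * snd (slot k) = 2 * k + 2)%nat.
Proof.
  unfold round; induction k as [|k IH]; [simpl; lia|].
  simpl; destruct (slot k) as [n i]; simpl in IH.
  destruct (Nat.ltb_spec i n); simpl; nia.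
Qed.

Lemma slot_lex (j k : nat) : (j < k)%nat ->
  (round j < round k \/ round j = round k /\ snd (slot j) < snd (slot k))%nat.
Proof.
  unfold round; induction 1 as [|k _ IH]; simpl.
  - destruct (slot j) as [n i]; destruct (Nat.ltb_spec i n); simpl; lia.
  - destruct (slot k) as [n i]; destruct (Nat.ltb_spec i n); simpl in *; lia.
Qed.

Lemma round_pos (k : nat) : 1 <= INR (round k).
Proof. apply (le_INR 1), slot_spec. Qed.

(* Directions of the first quadrant in the rational parametrisation of the circle;
   the first two are [(1, 0)] and [(0, 1)], whose strips bound the minimizers. *)
Definition param (k : nat) : R := INR (snd (slot k)) / INR (round k).
Definition dir1 (k : nat) : R := (1 - param k ^ 2) / (1 + param k ^ 2).
Definition dir2 (k : nat) : R := 2 * param k / (1 + param k ^ 2).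
Definition radius (n : nat) : R := 1 + / (2 * INR n).
Definition outer (k : nat) : R := radius (round k).
Definition inner (k : nat) : R := radius (S (round k)).

Lemma param_bounds (k : nat) : 0 <= param k <= 1.
Proof.
  destruct (slot_spec k) as [H _]; apply le_INR in H.
  pose proof (round_pos k); pose proof (pos_INR (snd (slot k))).
  unfold param; split.
  - apply Rdiv_le_0_compat; lra.
  - apply (Rmult_le_reg_r (INR (round k))); [lra|].
    unfold Rdiv; rewrite Rmult_assoc, Rinv_l; lra.
Qed.

Lemma dir_unit (k : nat) : dir1 k ^ 2 + dir2 k ^ 2 = 1.
Proof. unfold dir1, dir2; field; nra. Qed.

Lemma dir_bounds (k : nat) : 0 <= dir1 k <= 1 /\ 0 <= dir2 k <= 1.
Proof.
  pose proof (param_bounds k); pose proof (dir_unit k).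
  assert (0 <= dir1 k) by (apply Rdiv_le_0_compat; nra).
  assert (0 <= dir2 k) by (apply Rdiv_le_0_compat; nra).
  nra.
Qed.

(** The left side is the cosine of the angle between the two directions. Its exact value is
    [1 - 2 (s - t)^2 / ((1 + s^2) (1 + t^2))], and the denominator is at most [4]. *)
Lemma dir_separated (j k : nat) :
  dir1 j * dir1 k + dir2 j * dir2 k <= 1 - (param j - param k) ^ 2 / 2.
Proof.
  pose proof (param_bounds j); pose proof (param_bounds k).
  unfold dir1, dir2; set (s := param j) in *; set (t := param k) in *.
  assert (E : (1 - s ^ 2) / (1 + s ^ 2) * ((1 - t ^ 2) / (1 + t ^ 2))
     + 2 * s / (1 + s ^ 2) * (2 * t / (1 + t ^ 2))
     = 1 - 2 * (s - t) ^ 2 * / ((1 + s ^ 2) * (1 + t ^ 2)))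
    by (field; nra).
  rewrite E.
  assert (0 <= s ^ 2 <= 1) by nra; assert (0 <= t ^ 2 <= 1) by nra.
  assert (/ 4 <= / ((1 + s ^ 2) * (1 + t ^ 2))) by (apply Rinv_le_contravar; nra).
  pose proof (pow2_ge_0 (s - t)); nra.
Qed.

Lemma radius_bounds (n : nat) : (1 <= n)%nat -> 1 < radius n <= 3 / 2.
Proof.
  intros H; apply (le_INR 1) in H; simpl in H; unfold radius.
  assert (0 < / (2 * INR n)) by (apply Rinv_0_lt_compat; lra).
  assert (/ (2 * INR n) <= / 2) by (apply Rinv_le_contravar; lra).
  lra.
Qed.

Lemma radius_decr (m n : nat) : (1 <= m <= n)%nat -> radius n <= radius m.
Proof.
  intros [H H']; apply (le_INR 1) in H; apply le_INR in H'; simpl in H.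
  apply Rplus_le_compat_l, Rinv_le_contravar; lra.
Qed.

Lemma radius_gap (k : nat) :
  outer k - inner k = / (2 * INR (round k) * (INR (round k) + 1)).
Proof.
  pose proof (round_pos k); unfold outer, inner, radius; rewrite S_INR; field; lra.
Qed.

Lemma outer_bounds (k : nat) : 1 < outer k <= 3 / 2.
Proof. apply radius_bounds, slot_spec. Qed.

Lemma inner_bounds (k : nat) : 1 < inner k <= 3 / 2.
Proof. apply radius_bounds; lia. Qed.

(** The round [n] of [k] satisfies [n (n + 1) <= 2 k + 2]. The resulting bounds form a divergent
    harmonic series, which is the source of the final contradiction. *)
Lemma gap_lower (k : nat) : / (4 * (INR k + 1)) <= outer k - inner k.
Proof.
  rewrite radius_gap; pose proof (round_pos k).
  destruct (slot_spec k) as (_ & _ & E).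
  assert (H1 : (round k * (round k + 1) <= 2 * k + 2)%nat) by lia.
  apply le_INR in H1; rewrite mult_INR, !plus_INR, mult_INR in H1; simpl in H1.
  apply Rinv_le_contravar; nra.
Qed.

(** The tip of cut [k] lies inside every earlier strip. If [j] is in an earlier round, the disc has
    already shrunk to [inner j]. Within one round [n], separation costs at least [1 / (2 n^2)],
    which exceeds the gap [1 / (2 n (n + 1))]. *)
Lemma outer_inside (j k : nat) : (j < k)%nat ->
  outer k * (dir1 j * dir1 k + dir2 j * dir2 k) <= inner j.
Proof.
  intros Hjk; pose proof (dir_separated j k) as Hsep.
  pose proof (outer_bounds k).
  destruct (slot_lex j k Hjk) as [Hr | [Hr Hi]].
  - assert (outer k <= inner j) by (apply radius_decr; lia).
    pose proof (pow2_ge_0 (param j - param k)); nra.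
  - pose proof (radius_gap j) as Hg; pose proof (round_pos j) as Hp.
    assert (Ho : outer k = outer j) by (unfold outer; now rewrite Hr).
    (* Neighbouring parameters of a round differ by the inverse of its number. *)
    assert (Hd : / INR (round j) <= param k - param j).
    { unfold param; rewrite <- Hr; unfold Rdiv; rewrite <- Rmult_minus_distr_r.
      assert (0 < / INR (round j)) by (apply Rinv_0_lt_compat; lra).
      apply (le_INR (S _)) in Hi; rewrite S_INR in Hi; nra. }
    assert (0 < / INR (round j)) by (apply Rinv_0_lt_compat; lra).
    assert (Hn : / (2 * INR (round j) * (INR (round j) + 1)) <= / INR (round j) ^ 2 / 2).
    { replace (/ INR (round j) ^ 2 / 2) with (/ (2 * INR (round j) ^ 2)) by (field; lra).
      apply Rinv_le_contravar; nra. }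
    rewrite <- pow_inv in Hn.
    assert ((/ INR (round j)) ^ 2 <= (param j - param k) ^ 2) by nra.
    nra.
Qed.

(** * Rapidly decreasing weights *)

(* [flat_tip_le_notch] needs [24 * 64 <= 2000]. *)
Fixpoint weight (k : nat) : R :=
  match k with
  | O => 1
  | S k => weight k / (2000 * (INR k + 1) ^ 3)
  end.

Lemma weight_factor (k : nat) : 1 <= (INR k + 1) ^ 3.
Proof. pose proof (pos_INR k); apply pow_R1_Rle; lra. Qed.

Lemma weight_pos (k : nat) : 0 < weight k.
Proof.
  induction k; simpl weight; [lra|]; pose proof (weight_factor k).
  apply Rdiv_lt_0_compat; lra.
Qed.

Lemma weight_step (k : nat) : weight (S k) <= weight k / 2.
Proof.
  simpl weight; pose proof (weight_factor k); pose proof (weight_pos k).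
  apply Rmult_le_compat_l; [lra|]; apply Rinv_le_contravar; lra.
Qed.

Lemma weight_geom (n k : nat) : weight (n + k) <= weight n * (/ 2) ^ k.
Proof.
  induction k as [|k IH].
  - rewrite Nat.add_0_r; simpl; lra.
  - rewrite Nat.add_succ_r; pose proof (weight_step (n + k)); simpl pow; lra.
Qed.

Lemma ex_series_half : ex_series (fun k => (/ 2) ^ k).
Proof. apply ex_series_geom; rewrite Rabs_pos_eq; lra. Qed.

Lemma ex_series_weight : ex_series weight.
Proof.
  apply (ex_series_le (V := R_CompleteNormedModule) _ (fun k => (/ 2) ^ k));
    [|exact ex_series_half].
  intros k; change (Rabs (weight k) <= (/ 2) ^ k).
  pose proof (weight_geom 0 k) as H; simpl in H.
  rewrite Rabs_pos_eq; [lra|]; apply Rlt_le, weight_pos.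
Qed.

Lemma ex_series_weighted (x : nat -> R) (M : R) :
  (forall k, Rabs (x k) <= M) -> ex_series (fun k => weight k * x k).
Proof.
  intros H; apply (ex_series_le (V := R_CompleteNormedModule) _ (fun k => weight k * M)).
  - intros k; change (Rabs (weight k * x k) <= weight k * M).
    rewrite Rabs_mult, (Rabs_pos_eq (weight k)) by apply Rlt_le, weight_pos.
    apply Rmult_le_compat_l; [apply Rlt_le, weight_pos | apply H].
  - apply (ex_series_scal_r M weight), ex_series_weight.
Qed.

Lemma Series_weighted_bound (x : nat -> R) (M : R) :
  (forall k, Rabs (x k) <= M) ->
  Rabs (Series (fun k => weight k * x k)) <= M * Series weight.
Proof.
  intros H.
  assert (E : forall k, Rabs (weight k * x k) = weight k * Rabs (x k)).
  { intros k; rewrite Rabs_mult, (Rabs_pos_eq (weight k)); auto.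
    apply Rlt_le, weight_pos. }
  apply Rle_trans with (Series (fun k => Rabs (weight k * x k))).
  - apply Series_Rabs; apply (ex_series_ext (fun k => weight k * Rabs (x k))).
    + intros k; symmetry; apply E.
    + apply ex_series_weighted with M; intros k; rewrite Rabs_Rabsolu; apply H.
  - rewrite <- (Series_scal_l M weight); apply Series_le.
    + intros k; split; [apply Rabs_pos|]; rewrite E, Rmult_comm.
      apply Rmult_le_compat_r; [apply Rlt_le, weight_pos | apply H].
    + apply (ex_series_scal_l M weight), ex_series_weight.
Qed.

Lemma Series_weighted_le (x y : nat -> R) (M : R) :
  (forall k, 0 <= x k <= y k) -> (forall k, Rabs (y k) <= M) ->
  Series (fun k => weight k * x k) <= Series (fun k => weight k * y k).
Proof.
  intros H HM; apply Series_le; [|now apply ex_series_weighted with M].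
  intros k; specialize (H k); pose proof (weight_pos k); split; [nra|].
  apply Rmult_le_compat_l; lra.
Qed.

Lemma Series_nonneg (b : nat -> R) :
  (forall k, 0 <= b k) -> ex_series b -> 0 <= Series b.
Proof.
  intros H Hb; rewrite <- (Rmult_0_l (Series b)), <- Series_scal_l.
  apply Series_le; [|exact Hb]; intros k; specialize (H k); lra.
Qed.

Lemma term_le_Series (b : nat -> R) (k : nat) :
  (forall j, 0 <= b j) -> ex_series b -> b k <= Series b.
Proof.
  revert b; induction k as [|k IH]; intros b H Hb; rewrite Series_incr_1 by exact Hb.
  - enough (0 <= Series (fun k => b (S k))) by lra.
    apply Series_nonneg; [intros; apply H | now apply (ex_series_incr_1 b)].
  - pose proof (H 0%nat).
    enough (b (S k) <= Series (fun k => b (S k))) by lra.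
    apply (IH (fun k => b (S k))); [intros; apply H | now apply (ex_series_incr_1 b)].
Qed.

Lemma Series_weighted_term (x : nat -> R) (M : R) (k : nat) :
  (forall j, 0 <= x j <= M) -> weight k * x k <= Series (fun j => weight j * x j).
Proof.
  intros H; apply (term_le_Series (fun j => weight j * x j)).
  - intros j; specialize (H j); pose proof (weight_pos j); nra.
  - apply ex_series_weighted with M; intros j; specialize (H j).
    rewrite Rabs_pos_eq; lra.
Qed.

(** From index [k] on the weights are dominated by [weight k] times a geometric series of ratio
    [1/2], whose sum is [2]. *)
Lemma Series_weighted_tail (x : nat -> R) (M : R) (k : nat) :
  (forall j, 0 <= x j <= M) -> (forall j, (j < k)%nat -> x j = 0) ->
  Series (fun j => weight j * x j) <= 2 * M * weight k.
Proof.
  intros H H0.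
  rewrite (Series_incr_n_aux _ k) by (intros j Hj; rewrite H0 by exact Hj; ring).
  replace (2 * M * weight k) with (Series (fun j => M * weight k * (/ 2) ^ j)).
  - apply Series_le.
    + intros j; specialize (H (k + j)%nat); pose proof (weight_pos (k + j)).
      pose proof (weight_geom k j); split; [nra|].
      apply Rle_trans with (weight (k + j) * M); [apply Rmult_le_compat_l; lra|].
      replace (M * weight k * (/ 2) ^ j) with (weight k * (/ 2) ^ j * M) by ring.
      apply Rmult_le_compat_r; lra.
    + apply (ex_series_scal_l (M * weight k) (fun j => (/ 2) ^ j)), ex_series_half.
  - rewrite Series_scal_l, Series_geom by (rewrite Rabs_pos_eq; lra); field.
Qed.

(** * Series of ridge functions *)

Definition ell (k : nat) (p : R * R) : R := dir1 k * fst p + dir2 k * snd p.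

Lemma ell_bound (k : nat) (p : R * R) : Rabs (ell k p) <= Rabs (fst p) + Rabs (snd p).
Proof.
  destruct (dir_bounds k) as [H1 H2].
  eapply Rle_trans; [apply Rabs_triang|]; rewrite !Rabs_mult.
  rewrite (Rabs_pos_eq (dir1 k)), (Rabs_pos_eq (dir2 k)) by lra.
  pose proof (Rabs_pos (fst p)); pose proof (Rabs_pos (snd p)); nra.
Qed.

(** A common form for the function and its partial derivatives up to order two: a partial derivative
    multiplies [b k] by a component of the direction and replaces [g k] by its derivative. *)
Definition ridge (b : nat -> R) (g : nat -> R -> R) (p : R * R) : R :=
  Series (fun k => weight k * (b k * g k (ell k p))).

(** The bound is uniform in [k], so that it can be summed against the weights. *)
Definition locally_bounded (g : nat -> R -> R) : Prop :=
  forall B, exists M, forall k t, Rabs t <= B -> Rabs (g k t) <= M.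

Definition locally_lipschitz (g : nat -> R -> R) : Prop :=
  forall B, exists M, forall k t s, Rabs t <= B -> Rabs s <= B ->
    Rabs (g k s - g k t) <= M * Rabs (s - t).

Definition unit_bounded (b : nat -> R) : Prop := forall k, Rabs (b k) <= 1.

Lemma unit_bounded_mult (b c : nat -> R) :
  unit_bounded b -> unit_bounded c -> unit_bounded (fun k => b k * c k).
Proof.
  intros Hb Hc k; rewrite Rabs_mult; specialize (Hb k); specialize (Hc k).
  pose proof (Rabs_pos (b k)); pose proof (Rabs_pos (c k)); nra.
Qed.

Lemma unit_bounded_dir1 : unit_bounded dir1.
Proof. intros k; destruct (dir_bounds k); rewrite Rabs_pos_eq; lra. Qed.

Lemma unit_bounded_dir2 : unit_bounded dir2.
Proof. intros k; destruct (dir_bounds k); rewrite Rabs_pos_eq; lra. Qed.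

Lemma Rabs_mult_unit (b x M : R) : Rabs b <= 1 -> Rabs x <= M -> Rabs (b * x) <= M.
Proof.
  intros; rewrite Rabs_mult; pose proof (Rabs_pos b); pose proof (Rabs_pos x); nra.
Qed.

Lemma ridge_bounded_terms (b : nat -> R) (g : nat -> R -> R) (p : R * R) :
  unit_bounded b -> locally_bounded g ->
  exists M, forall k, Rabs (b k * g k (ell k p)) <= M.
Proof.
  intros Hb Hg; destruct (Hg (Rabs (fst p) + Rabs (snd p))) as [M HM].
  exists M; intros k; apply Rabs_mult_unit; [apply Hb | apply HM, ell_bound].
Qed.

Lemma ex_series_ridge (b : nat -> R) (g : nat -> R -> R) (p : R * R) :
  unit_bounded b -> locally_bounded g ->
  ex_series (fun k => weight k * (b k * g k (ell k p))).
Proof.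
  intros Hb Hg; destruct (ridge_bounded_terms b g p Hb Hg) as [M HM].
  now apply ex_series_weighted with M.
Qed.

Lemma continuous_of_local_lipschitz (F : R * R -> R) (p : R * R) (L : R) :
  (forall q, Rabs (fst q - fst p) <= 1 -> Rabs (snd q - snd p) <= 1 ->
     Rabs (F q - F p) <= L * (Rabs (fst q - fst p) + Rabs (snd q - snd p))) ->
  continuous F p.
Proof.
  destruct p as [p1 p2]; intros H; apply filterlim_locally; intros eps.
  set (L' := Rabs L + 1).
  assert (HL : 0 < L') by (unfold L'; pose proof (Rabs_pos L); lra).
  assert (Hd : 0 < Rmin 1 (eps / (2 * L'))).
  { apply Rmin_pos; [lra|]; apply Rdiv_lt_0_compat; [apply cond_pos | lra]. }
  exists (mkposreal _ Hd); intros [q1 q2] [H1 H2].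
  change (Rabs (q1 - p1) < Rmin 1 (eps / (2 * L'))) in H1.
  change (Rabs (q2 - p2) < Rmin 1 (eps / (2 * L'))) in H2.
  change (Rabs (F (q1, q2) - F (p1, p2)) < eps).
  pose proof (Rmin_l 1 (eps / (2 * L'))); pose proof (Rmin_r 1 (eps / (2 * L'))).
  eapply Rle_lt_trans; [apply H; simpl; lra|].
  simpl fst; simpl snd; apply Rle_lt_trans with (L' * (Rabs (q1 - p1) + Rabs (q2 - p2))).
  - apply Rmult_le_compat_r.
    + pose proof (Rabs_pos (q1 - p1)); pose proof (Rabs_pos (q2 - p2)); lra.
    + unfold L'; pose proof (Rle_abs L); lra.
  - apply Rlt_le_trans with (L' * (2 * (eps / (2 * L')))).
    + apply Rmult_lt_compat_l; lra.
    + right; field; lra.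
Qed.

(** Lipschitz constants uniform in [k] sum against the weights to a local Lipschitz constant of the
    series. *)
Lemma continuous_ridge (b : nat -> R) (g : nat -> R -> R) (p : R * R) :
  unit_bounded b -> locally_bounded g -> locally_lipschitz g ->
  continuous (ridge b g) p.
Proof.
  intros Hb Hg Hl.
  (* The extra [2] covers [ell k q] for all [q] within [1] of [p] in each coordinate. *)
  destruct (Hl (Rabs (fst p) + Rabs (snd p) + 2)) as [M HM].
  apply continuous_of_local_lipschitz with (Rabs M * Series weight); intros q H1 H2.
  unfold ridge; rewrite <- Series_minus by now apply ex_series_ridge.
  rewrite (Series_ext _ (fun k => weight k *
    (b k * (g k (ell k q) - g k (ell k p))))) by (intros; ring).
  set (r := Rabs (fst q - fst p) + Rabs (snd q - snd p)).
  replace (Rabs M * Series weight * r) with (Rabs M * r * Series weight) by ring.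
  apply Series_weighted_bound; intros k; apply Rabs_mult_unit; [apply Hb|].
  eapply Rle_trans; [apply HM|].
  - pose proof (ell_bound k p) as Hp; lra.
  - pose proof (ell_bound k q) as Hq.
    pose proof (Rabs_triang_inv (fst q) (fst p)).
    pose proof (Rabs_triang_inv (snd q) (snd p)); lra.
  - replace (ell k q - ell k p) with (ell k (fst q - fst p, snd q - snd p))
      by (unfold ell; simpl; ring).
    apply Rle_trans with (Rabs M * Rabs (ell k (fst q - fst p, snd q - snd p))).
    + apply Rmult_le_compat_r; [apply Rabs_pos | apply Rle_abs].
    + apply Rmult_le_compat_l; [apply Rabs_pos | apply ell_bound].
Qed.

(** * Termwise differentiation of ridge series *)

(** A quadratic remainder bound can be summed over a series, so this criterion replaces a theorem on
    uniform convergence of derivatives. *)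
Lemma is_derive_of_quadratic (F : R -> R) (x l K : R) :
  (forall h, Rabs h <= 1 -> Rabs (F (x + h) - F x - h * l) <= K * h ^ 2) ->
  is_derive F x l.
Proof.
  intros H; apply is_derive_Reals; intros eps Heps.
  set (K' := Rabs K + 1).
  assert (HK : 0 < K') by (unfold K'; pose proof (Rabs_pos K); lra).
  assert (Hd : 0 < Rmin 1 (eps / K')).
  { apply Rmin_pos; [lra|]; apply Rdiv_lt_0_compat; lra. }
  exists (mkposreal _ Hd); simpl; intros h Hh0 Hh.
  pose proof (Rmin_l 1 (eps / K')); pose proof (Rmin_r 1 (eps / K')).
  replace ((F (x + h) - F x) / h - l) with ((F (x + h) - F x - h * l) / h)
    by (field; exact Hh0).
  pose proof (Rabs_pos_lt h Hh0).
  unfold Rdiv at 1; rewrite Rabs_mult, Rabs_inv.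
  apply Rle_lt_trans with (K' * Rabs h).
  - apply (Rmult_le_reg_r (Rabs h)); [lra|].
    rewrite Rmult_assoc, Rinv_l, Rmult_1_r by lra.
    eapply Rle_trans; [apply H; lra|].
    rewrite Rmult_assoc, <- Rabs_mult, (Rabs_pos_eq (h * h)) by nra.
    replace (h ^ 2) with (h * h) by ring.
    apply Rmult_le_compat_r; [nra|]; unfold K'; pose proof (Rle_abs K); lra.
  - apply Rlt_le_trans with (K' * (eps / K')).
    + apply Rmult_lt_compat_l; lra.
    + right; field; lra.
Qed.

Definition shift (p v : R * R) (s : R) : R * R :=
  (fst p + s * fst v, snd p + s * snd v).

Lemma Rabs_mean_value (F dF : R -> R) (B M s t : R) :
  (forall x, is_derive F x (dF x)) ->
  (forall x, Rabs x <= B -> Rabs (dF x) <= M) ->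
  Rabs s <= B -> Rabs t <= B -> Rabs (F s - F t) <= M * Rabs (s - t).
Proof.
  intros HF HM Hs Ht.
  destruct (MVT_gen F t s dF) as (x & Hx & E).
  - intros; apply HF.
  - intros; apply continuity_pt_filterlim, (ex_derive_continuous F).
    eexists; apply HF.
  - rewrite E, Rabs_mult; apply Rmult_le_compat_r; [apply Rabs_pos|].
    apply HM; revert Hx Hs Ht; unfold Rmin, Rmax, Rabs.
    repeat (destruct Rle_dec || destruct Rcase_abs); lra.
Qed.

(** The mean value theorem turns the remainder into [(dF x - dF t) * (s - t)] with [x] between [t]
    and [s]. [Rabs M] spares a sign condition on [M]. *)
Lemma Rabs_taylor1 (F dF : R -> R) (B M s t : R) :
  (forall x, is_derive F x (dF x)) ->
  (forall x y, Rabs x <= B -> Rabs y <= B -> Rabs (dF y - dF x) <= M * Rabs (y - x)) ->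
  Rabs s <= B -> Rabs t <= B ->
  Rabs (F s - F t - (s - t) * dF t) <= Rabs M * (s - t) ^ 2.
Proof.
  intros HF HM Hs Ht.
  destruct (MVT_gen F t s dF) as (x & Hx & E).
  - intros; apply HF.
  - intros; apply continuity_pt_filterlim, (ex_derive_continuous F).
    eexists; apply HF.
  - rewrite E.
    replace (dF x * (s - t) - (s - t) * dF t) with ((dF x - dF t) * (s - t)) by ring.
    rewrite Rabs_mult, <- pow2_abs.
    assert (Hxb : Rabs x <= B /\ Rabs (x - t) <= Rabs (s - t)).
    { revert Hx Hs Ht; unfold Rmin, Rmax, Rabs.
      repeat (destruct Rle_dec || destruct Rcase_abs); lra. }
    destruct Hxb as [Hxb Hxt].
    replace (Rabs M * Rabs (s - t) ^ 2) with (Rabs M * Rabs (s - t) * Rabs (s - t)) by ring.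
    apply Rmult_le_compat_r; [apply Rabs_pos|].
    eapply Rle_trans; [now apply HM|].
    apply Rle_trans with (Rabs M * Rabs (x - t)).
    + apply Rmult_le_compat_r; [apply Rabs_pos | apply Rle_abs].
    + apply Rmult_le_compat_l; [apply Rabs_pos | exact Hxt].
Qed.

(** The first-order Taylor remainders of the terms are bounded uniformly in [k] and summed. An
    arbitrary direction [v] yields both the partial derivatives and the derivative along rays. *)
Lemma is_derive_ridge_line (b : nat -> R) (g dg : nat -> R -> R) (p v : R * R) (s : R) :
  unit_bounded b -> locally_bounded g -> locally_bounded dg -> locally_lipschitz dg ->
  (forall k t, is_derive (g k) t (dg k t)) ->
  is_derive (fun s => ridge b g (shift p v s)) s
    (fst v * ridge (fun k => b k * dir1 k) dg (shift p v s) +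
     snd v * ridge (fun k => b k * dir2 k) dg (shift p v s)).
Proof.
  intros Hb Hg Hdg Hl Hd.
  set (V := Rabs (fst v) + Rabs (snd v)).
  (* [B] bounds every [ell k] along the line for parameters of absolute value at most [Rabs s + 1],
     which covers all increments [h] with [Rabs h <= 1]. *)
  set (B := Rabs (fst p) + Rabs (snd p) + (Rabs s + 1) * V).
  assert (HV : 0 <= V)
    by (unfold V; pose proof (Rabs_pos (fst v)); pose proof (Rabs_pos (snd v)); lra).
  destruct (Hl B) as [M HM].
  assert (HB : forall k s', Rabs s' <= Rabs s + 1 -> Rabs (ell k (shift p v s')) <= B).
  { intros k s' Hs'; eapply Rle_trans; [apply ell_bound|]; unfold shift, B, V; simpl.
    pose proof (Rabs_triang (fst p) (s' * fst v)).
    pose proof (Rabs_triang (snd p) (s' * snd v)).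
    rewrite !Rabs_mult in *.
    pose proof (Rabs_pos (fst v)); pose proof (Rabs_pos (snd v)); nra. }
  apply is_derive_of_quadratic with (Rabs M * V ^ 2 * Series weight); intros h Hh.
  assert (Hs1 : Rabs (s + h) <= Rabs s + 1) by (pose proof (Rabs_triang s h); lra).
  assert (Hs0 : Rabs s <= Rabs s + 1) by lra.
  pose proof (unit_bounded_mult b dir1 Hb unit_bounded_dir1) as Hb1.
  pose proof (unit_bounded_mult b dir2 Hb unit_bounded_dir2) as Hb2.
  set (W := Series weight); unfold ridge.
  rewrite <- !Series_scal_l, <- Series_plus, <- Series_scal_l.
  2, 3: apply (ex_series_scal_l (V := R_NormedModule)); now apply ex_series_ridge.
  rewrite <- Series_minus by now apply ex_series_ridge.
  rewrite <- Series_minus.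
  2: { apply (ex_series_minus (V := R_NormedModule)); now apply ex_series_ridge. }
  2: { apply (ex_series_scal_l (V := R_NormedModule)), (ex_series_plus (V := R_NormedModule));
       apply (ex_series_scal_l (V := R_NormedModule)); now apply ex_series_ridge. }
  rewrite (Series_ext _ (fun k => weight k * (b k *
    (g k (ell k (shift p v (s + h))) - g k (ell k (shift p v s))
     - (ell k (shift p v (s + h)) - ell k (shift p v s)) * dg k (ell k (shift p v s)))))).
  2: { intros k.
       replace (ell k (shift p v (s + h)) - ell k (shift p v s))
         with (h * (dir1 k * fst v + dir2 k * snd v)) by (unfold ell, shift; simpl; ring).
       ring. }
  replace (Rabs M * V ^ 2 * W * h ^ 2)
    with (Rabs M * (V ^ 2 * h ^ 2) * W) by ring.
  apply Series_weighted_bound; intros k; apply Rabs_mult_unit; [apply Hb|].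
  eapply Rle_trans.
  - apply (Rabs_taylor1 (g k) (dg k) B M); auto.
  - replace (ell k (shift p v (s + h)) - ell k (shift p v s)) with (h * ell k v)
      by (unfold ell, shift; simpl; ring).
    apply Rmult_le_compat_l; [apply Rabs_pos|].
    rewrite Rpow_mult_distr, Rmult_comm.
    apply Rmult_le_compat_r; [apply pow2_ge_0|].
    apply pow_maj_Rabs; apply ell_bound.
Qed.

Lemma is_derive_ridge_1 (b : nat -> R) (g dg : nat -> R -> R) (p : R * R) :
  unit_bounded b -> locally_bounded g -> locally_bounded dg -> locally_lipschitz dg ->
  (forall k t, is_derive (g k) t (dg k t)) ->
  is_derive (fun t => ridge b g (t, snd p)) (fst p) (ridge (fun k => b k * dir1 k) dg p).
Proof.
  intros Hb Hg Hdg Hl Hd.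
  pose proof (is_derive_ridge_line b g dg (0, snd p) (1, 0) (fst p) Hb Hg Hdg Hl Hd) as H.
  assert (E : forall t, shift (0, snd p) (1, 0) t = (t, snd p))
    by (intros; unfold shift; simpl; f_equal; ring).
  rewrite E, <- surjective_pairing in H; simpl in H.
  rewrite Rmult_1_l, Rmult_0_l, Rplus_0_r in H.
  refine (is_derive_ext _ _ _ _ _ H); intros t; simpl; now rewrite E.
Qed.

Lemma is_derive_ridge_2 (b : nat -> R) (g dg : nat -> R -> R) (p : R * R) :
  unit_bounded b -> locally_bounded g -> locally_bounded dg -> locally_lipschitz dg ->
  (forall k t, is_derive (g k) t (dg k t)) ->
  is_derive (fun t => ridge b g (fst p, t)) (snd p) (ridge (fun k => b k * dir2 k) dg p).
Proof.
  intros Hb Hg Hdg Hl Hd.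
  pose proof (is_derive_ridge_line b g dg (fst p, 0) (0, 1) (snd p) Hb Hg Hdg Hl Hd) as H.
  assert (E : forall t, shift (fst p, 0) (0, 1) t = (fst p, t))
    by (intros; unfold shift; simpl; f_equal; ring).
  rewrite E, <- surjective_pairing in H; simpl in H.
  rewrite Rmult_1_l, Rmult_0_l, Rplus_0_l in H.
  refine (is_derive_ext _ _ _ _ _ H); intros t; simpl; now rewrite E.
Qed.

(** The partial derivatives are identified as functions, and again as ridge series, so that the
    lemma applies to them in turn and gives C2. *)
Lemma C1_ridge (b : nat -> R) (g dg : nat -> R -> R) :
  unit_bounded b -> locally_bounded g -> locally_lipschitz g ->
  locally_bounded dg -> locally_lipschitz dg ->
  (forall k t, is_derive (g k) t (dg k t)) ->
  C1_2d (ridge b g) /\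
  pd1 (ridge b g) = ridge (fun k => b k * dir1 k) dg /\
  pd2 (ridge b g) = ridge (fun k => b k * dir2 k) dg.
Proof.
  intros Hb Hg Hgl Hdg Hl Hd.
  assert (E1 : pd1 (ridge b g) = ridge (fun k => b k * dir1 k) dg).
  { apply functional_extensionality; intros p; now apply is_derive_unique, is_derive_ridge_1. }
  assert (E2 : pd2 (ridge b g) = ridge (fun k => b k * dir2 k) dg).
  { apply functional_extensionality; intros p; now apply is_derive_unique, is_derive_ridge_2. }
  split; [|now split]; unfold C1_2d; rewrite E1, E2.
  split; [|split]; intros p; [|split|split].
  - now apply continuous_ridge.
  - eexists; now apply (is_derive_ridge_1 b g dg).
  - eexists; now apply (is_derive_ridge_2 b g dg).
  - apply continuous_ridge; auto; now apply unit_bounded_mult, unit_bounded_dir1.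
  - apply continuous_ridge; auto; now apply unit_bounded_mult, unit_bounded_dir2.
Qed.

(** * The function *)

Definition pos (z : R) : R := Rmax 0 z.
(** The third power is the smallest integer power of the positive part that is C2. *)
Definition profile (k : nat) (t : R) : R := pos (t ^ 2 - inner k ^ 2) ^ 3.
Definition dprofile (k : nat) (t : R) : R := 6 * t * pos (t ^ 2 - inner k ^ 2) ^ 2.
Definition ddprofile (k : nat) (t : R) : R :=
  6 * pos (t ^ 2 - inner k ^ 2) ^ 2 + 24 * t ^ 2 * pos (t ^ 2 - inner k ^ 2).

Lemma pos_cases (z : R) : (z <= 0 /\ pos z = 0) \/ (0 < z /\ pos z = z).
Proof. unfold pos, Rmax; destruct Rle_dec; [|left; lra]; destruct (Req_dec z 0); lra. Qed.

Lemma pos_nonneg (z : R) : 0 <= pos z.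
Proof. apply Rmax_l. Qed.

Lemma pos_lipschitz (z w : R) : Rabs (pos z - pos w) <= Rabs (z - w).
Proof.
  destruct (pos_cases z) as [[? ->]|[? ->]], (pos_cases w) as [[? ->]|[? ->]];
    unfold Rabs; repeat destruct Rcase_abs; lra.
Qed.

Lemma is_derive_pos_sqr (z : R) : is_derive (fun z => pos z ^ 2) z (2 * pos z).
Proof.
  apply is_derive_of_quadratic with 1; intros h _.
  apply Rabs_le.
  destruct (pos_cases z) as [[? ->]|[? ->]], (pos_cases (z + h)) as [[? ->]|[? ->]]; nra.
Qed.

(** Since [pos z ^ 3 = z * pos z ^ 2], the product rule reduces the cube to the square. *)
Lemma is_derive_pos_cube (z : R) : is_derive (fun z => pos z ^ 3) z (3 * pos z ^ 2).
Proof.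
  apply (is_derive_ext (fun z => z * pos z ^ 2)).
  - intros t; destruct (pos_cases t) as [[? ->]|[? ->]]; simpl; ring.
  - replace (3 * pos z ^ 2) with (1 * pos z ^ 2 + z * (2 * pos z))
      by (destruct (pos_cases z) as [[? ->]|[? ->]]; ring).
    apply (is_derive_mult (fun z => z) (fun z => pos z ^ 2)).
    + apply (is_derive_id (K := R_AbsRing)).
    + apply is_derive_pos_sqr.
    + intros; apply Rmult_comm.
Qed.

Lemma is_derive_quadratic (c t : R) : is_derive (fun t => t ^ 2 - c) t (2 * t).
Proof. auto_derive; [exact I | ring]. Qed.

Lemma is_derive_profile (k : nat) (t : R) : is_derive (profile k) t (dprofile k t).
Proof.
  unfold dprofile; replace (6 * t * pos (t ^ 2 - inner k ^ 2) ^ 2)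
    with (2 * t * (3 * pos (t ^ 2 - inner k ^ 2) ^ 2)) by ring.
  apply (is_derive_comp (fun z => pos z ^ 3)).
  - apply is_derive_pos_cube.
  - apply is_derive_quadratic.
Qed.

Lemma is_derive_dprofile (k : nat) (t : R) : is_derive (dprofile k) t (ddprofile k t).
Proof.
  unfold ddprofile.
  replace (6 * pos (t ^ 2 - inner k ^ 2) ^ 2 + 24 * t ^ 2 * pos (t ^ 2 - inner k ^ 2))
    with (6 * pos (t ^ 2 - inner k ^ 2) ^ 2
          + 6 * t * (2 * t * (2 * pos (t ^ 2 - inner k ^ 2)))) by ring.
  apply (is_derive_mult (fun t => 6 * t) (fun t => pos (t ^ 2 - inner k ^ 2) ^ 2)).
  - auto_derive; [exact I | ring].
  - apply (is_derive_comp (fun z => pos z ^ 2)).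
    + apply is_derive_pos_sqr.
    + apply is_derive_quadratic.
  - intros; apply Rmult_comm.
Qed.

Lemma pos_inner_bound (k : nat) (B t : R) :
  Rabs t <= B -> 0 <= t ^ 2 <= B ^ 2 /\ 0 <= pos (t ^ 2 - inner k ^ 2) <= B ^ 2.
Proof.
  intros H.
  assert (t ^ 2 <= B ^ 2) by now apply pow_maj_Rabs.
  pose proof (pow2_ge_0 t); pose proof (pow2_ge_0 (inner k)).
  destruct (pos_cases (t ^ 2 - inner k ^ 2)) as [[? ->]|[? ->]]; lra.
Qed.

Lemma bounded_profile : locally_bounded profile.
Proof.
  intros B; exists ((B ^ 2) ^ 3); intros k t H; unfold profile.
  destruct (pos_inner_bound k B t H) as [_ Hp].
  rewrite Rabs_pos_eq by (apply pow_le; lra); apply pow_incr; lra.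
Qed.

Lemma bounded_dprofile : locally_bounded dprofile.
Proof.
  intros B; exists (6 * B * (B ^ 2) ^ 2); intros k t H; unfold dprofile.
  destruct (pos_inner_bound k B t H) as [_ Hp].
  pose proof (Rabs_pos t).
  rewrite !Rabs_mult, (Rabs_pos_eq 6), (Rabs_pos_eq (pos _ ^ 2)) by (try apply pow_le; lra).
  apply Rmult_le_compat; try lra; [apply pow_le; lra | apply pow_incr; lra].
Qed.

Lemma bounded_ddprofile : locally_bounded ddprofile.
Proof.
  intros B; exists (30 * (B ^ 2) ^ 2); intros k t H; unfold ddprofile.
  destruct (pos_inner_bound k B t H) as [Ht Hp].
  set (z := pos _) in *; rewrite Rabs_pos_eq by nra; nra.
Qed.

Lemma lipschitz_profile : locally_lipschitz profile.
Proof.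
  intros B; destruct (bounded_dprofile B) as [M HM]; exists M; intros k t s Ht Hs.
  apply (Rabs_mean_value (profile k) (dprofile k) B); auto using is_derive_profile.
Qed.

Lemma lipschitz_dprofile : locally_lipschitz dprofile.
Proof.
  intros B; destruct (bounded_ddprofile B) as [M HM]; exists M; intros k t s Ht Hs.
  apply (Rabs_mean_value (dprofile k) (ddprofile k) B); auto using is_derive_dprofile.
Qed.

Lemma lipschitz_ddprofile : locally_lipschitz ddprofile.
Proof.
  (* [ddprofile] has kinks, so the difference is factored instead of using a mean value: the
     coefficients are at most [36 B^2] and [24 B^2], and each increment is at most [2 B |s - t|]. *)
  intros B; exists (120 * B * B ^ 2); intros k t s Ht Hs; unfold ddprofile.
  destruct (pos_inner_bound k B t Ht) as [Ht2 Hp].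
  destruct (pos_inner_bound k B s Hs) as [Hs2 Hq].
  pose proof (pos_lipschitz (s ^ 2 - inner k ^ 2) (t ^ 2 - inner k ^ 2)) as Hl.
  replace (s ^ 2 - inner k ^ 2 - (t ^ 2 - inner k ^ 2)) with (s ^ 2 - t ^ 2) in Hl by ring.
  set (p := pos (t ^ 2 - inner k ^ 2)) in *; set (q := pos (s ^ 2 - inner k ^ 2)) in *.
  assert (Hd : Rabs (s ^ 2 - t ^ 2) <= 2 * B * Rabs (s - t)).
  { replace (s ^ 2 - t ^ 2) with ((s + t) * (s - t)) by ring; rewrite Rabs_mult.
    apply Rmult_le_compat_r; [apply Rabs_pos|].
    pose proof (Rabs_triang s t); lra. }
  set (d := 2 * B * Rabs (s - t)) in *.
  replace (120 * B * B ^ 2 * Rabs (s - t)) with (60 * (B ^ 2 * d)) by (unfold d; ring).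
  replace (6 * q ^ 2 + 24 * s ^ 2 * q - (6 * p ^ 2 + 24 * t ^ 2 * p))
    with ((6 * (q + p) + 24 * s ^ 2) * (q - p) + 24 * p * (s ^ 2 - t ^ 2)) by ring.
  eapply Rle_trans; [apply Rabs_triang|]; rewrite !(Rabs_mult _ (_ - _)).
  rewrite !(Rabs_pos_eq (_ + _)), (Rabs_pos_eq (24 * p)) by nra.
  pose proof (Rabs_pos (q - p)); pose proof (Rabs_pos (s ^ 2 - t ^ 2)).
  assert (Hprod : forall x y z, 0 <= x <= z * B ^ 2 -> 0 <= y <= d -> x * y <= z * (B ^ 2 * d)).
  { intros x y z Hx Hy; rewrite <- Rmult_assoc; apply Rmult_le_compat; lra. }
  replace (60 * (B ^ 2 * d)) with (36 * (B ^ 2 * d) + 24 * (B ^ 2 * d)) by ring.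
  apply Rplus_le_compat; apply Hprod; lra.
Qed.

Definition flat : R * R -> R := ridge (fun _ => 1) profile.

Lemma unit_bounded_1 : unit_bounded (fun _ => 1).
Proof. intros k; rewrite Rabs_R1; lra. Qed.

#[local] Hint Resolve unit_bounded_1 unit_bounded_mult unit_bounded_dir1 unit_bounded_dir2
  bounded_profile bounded_dprofile bounded_ddprofile lipschitz_profile lipschitz_dprofile
  lipschitz_ddprofile is_derive_profile is_derive_dprofile : ridge.

Lemma C2_flat : C2_2d flat.
Proof.
  destruct (C1_ridge (fun _ => 1) profile dprofile) as (H & E1 & E2); auto with ridge.
  unfold C2_2d, flat; rewrite E1, E2.
  split; [exact H|]; split; apply C1_ridge with ddprofile; auto with ridge.
Qed.

Definition slope1 : R * R -> R := ridge dir1 dprofile.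
Definition slope2 : R * R -> R := ridge dir2 dprofile.

Lemma ridge_ext (b c : nat -> R) (g : nat -> R -> R) (p : R * R) :
  (forall k, b k = c k) -> ridge b g p = ridge c g p.
Proof. intros H; apply Series_ext; intros k; now rewrite H. Qed.

Lemma is_derive_flat_1 (p : R * R) :
  is_derive (fun t => flat (t, snd p)) (fst p) (slope1 p).
Proof.
  unfold slope1; rewrite (ridge_ext dir1 (fun k => 1 * dir1 k)) by (intros; ring).
  apply is_derive_ridge_1; auto with ridge.
Qed.

Lemma is_derive_flat_2 (p : R * R) :
  is_derive (fun t => flat (fst p, t)) (snd p) (slope2 p).
Proof.
  unfold slope2; rewrite (ridge_ext dir2 (fun k => 1 * dir2 k)) by (intros; ring).
  apply is_derive_ridge_2; auto with ridge.
Qed.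

Definition ray (y : R * R) (s : R) : R * R := (s * fst y, s * snd y).

Lemma is_derive_flat_ray (y : R * R) (s : R) :
  is_derive (fun s => flat (ray y s)) s
    (fst y * slope1 (ray y s) + snd y * slope2 (ray y s)).
Proof.
  assert (E : forall t, shift (0, 0) y t = ray y t)
    by (intros; unfold shift, ray; simpl; f_equal; ring).
  pose proof (is_derive_ridge_line (fun _ => 1) profile dprofile (0, 0) y s) as H.
  rewrite E in H.
  rewrite (ridge_ext (fun k => 1 * dir1 k) dir1), (ridge_ext (fun k => 1 * dir2 k) dir2)
    in H by (intros; ring).
  apply (is_derive_ext (fun s => ridge (fun _ => 1) profile (shift (0, 0) y s))).
  - intros t; now rewrite E.
  - apply H; auto with ridge.
Qed.

(** * Sign, convexity and zero set of [flat] *)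

Lemma profile_nonneg (k : nat) (t : R) : 0 <= profile k t.
Proof. apply pow_le, pos_nonneg. Qed.

Lemma flat_terms (p : R * R) :
  exists M, forall k, 0 <= 1 * profile k (ell k p) <= M.
Proof.
  destruct (ridge_bounded_terms (fun _ => 1) profile p) as [M HM]; auto with ridge.
  exists M; intros k; pose proof (profile_nonneg k (ell k p)); split; [lra|].
  eapply Rle_trans; [apply Rle_abs | apply HM].
Qed.

Lemma flat_nonneg (p : R * R) : 0 <= flat p.
Proof.
  apply Series_nonneg; [|apply ex_series_ridge; auto with ridge].
  intros k; pose proof (weight_pos k); pose proof (profile_nonneg k (ell k p)); nra.
Qed.

Lemma flat_ge_term (k : nat) (p : R * R) : weight k * profile k (ell k p) <= flat p.
Proof.
  destruct (flat_terms p) as [M HM].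
  pose proof (Series_weighted_term (fun k => 1 * profile k (ell k p)) M k HM) as H.
  cbv beta in H; rewrite Rmult_1_l in H; exact H.
Qed.

Lemma pos_convex (c s t l : R) : 0 <= l <= 1 ->
  pos ((l * s + (1 - l) * t) ^ 2 - c) <= l * pos (s ^ 2 - c) + (1 - l) * pos (t ^ 2 - c).
Proof.
  intros Hl; unfold pos at 1; apply Rmax_lub.
  - pose proof (pos_nonneg (s ^ 2 - c)); pose proof (pos_nonneg (t ^ 2 - c)); nra.
  - pose proof (Rmax_r 0 (s ^ 2 - c)) as H1; pose proof (Rmax_r 0 (t ^ 2 - c)) as H2.
    fold (pos (s ^ 2 - c)) in H1; fold (pos (t ^ 2 - c)) in H2.
    assert ((l * s + (1 - l) * t) ^ 2 <= l * s ^ 2 + (1 - l) * t ^ 2).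
    { pose proof (Rmult_le_pos (l * (1 - l)) ((s - t) ^ 2)) as H.
      pose proof (pow2_ge_0 (s - t)); nra. }
    nra.
Qed.

Lemma cube_convex (a b l : R) : 0 <= a -> 0 <= b -> 0 <= l <= 1 ->
  (l * a + (1 - l) * b) ^ 3 <= l * a ^ 3 + (1 - l) * b ^ 3.
Proof.
  intros Ha Hb Hl.
  (* This product is exactly the right side minus the left side. *)
  assert (0 <= l * (1 - l) * (a - b) ^ 2 * ((1 + l) * a + (2 - l) * b)).
  { pose proof (pow2_ge_0 (a - b)) as Hd.
    apply Rmult_le_pos; [apply Rmult_le_pos; [nra | exact Hd] | nra]. }
  nra.
Qed.

Lemma profile_convex (k : nat) (s t l : R) : 0 <= l <= 1 ->
  profile k (l * s + (1 - l) * t) <= l * profile k s + (1 - l) * profile k t.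
Proof.
  intros Hl; unfold profile.
  eapply Rle_trans; [|apply cube_convex; auto using pos_nonneg].
  apply pow_incr; split; [apply pos_nonneg | now apply pos_convex].
Qed.

Lemma flat_convex : convex2 flat.
Proof.
  intros p q l Hl; unfold flat, ridge.
  rewrite <- !Series_scal_l, <- Series_plus
    by (apply (ex_series_scal_l (V := R_NormedModule)), ex_series_ridge; auto with ridge).
  apply Series_le.
  - intros k; pose proof (weight_pos k).
    replace (ell k (l * fst p + (1 - l) * fst q, l * snd p + (1 - l) * snd q))
      with (l * ell k p + (1 - l) * ell k q) by (unfold ell; simpl; ring).
    pose proof (profile_convex k (ell k p) (ell k q) l Hl).
    pose proof (profile_nonneg k (l * ell k p + (1 - l) * ell k q)).
    split; [nra|].
    replace (l * (weight k * (1 * profile k (ell k p))) +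
             (1 - l) * (weight k * (1 * profile k (ell k q))))
      with (weight k * (l * profile k (ell k p) + (1 - l) * profile k (ell k q))) by ring.
    apply Rmult_le_compat_l; lra.
  - apply (ex_series_plus (V := R_NormedModule));
      apply (ex_series_scal_l (V := R_NormedModule)), ex_series_ridge; auto with ridge.
Qed.

Lemma profile_eq_0 (k : nat) (t : R) : profile k t = 0 <-> Rabs t <= inner k.
Proof.
  pose proof (inner_bounds k); unfold profile.
  destruct (pos_cases (t ^ 2 - inner k ^ 2)) as [[H1 ->]|[H1 ->]]; split; intros H2.
  - rewrite <- (Rabs_pos_eq (inner k)) by lra.
    apply Rsqr_le_abs_0; unfold Rsqr; lra.
  - ring.
  - exfalso; pose proof (pow_lt _ 3 H1); lra.
  - exfalso; apply pow_maj_Rabs with (n := 2%nat) in H2; lra.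
Qed.

Lemma flat_eq_0 (p : R * R) : (forall k, Rabs (ell k p) <= inner k) -> flat p = 0.
Proof.
  intros H; unfold flat, ridge.
  rewrite (Series_ext _ (fun k => 0 * weight k)), Series_scal_l; [ring|].
  intros k; specialize (H k); rewrite <- profile_eq_0 in H; rewrite H; ring.
Qed.

Lemma flat_zero_near_origin (p : R * R) : Rabs (fst p) + Rabs (snd p) <= 1 -> flat p = 0.
Proof.
  intros H; apply flat_eq_0; intros k.
  pose proof (ell_bound k p); pose proof (inner_bounds k); lra.
Qed.

Lemma flat_zero_inner (p : R * R) (k : nat) : flat p = 0 -> Rabs (ell k p) <= inner k.
Proof.
  intros H; apply profile_eq_0; pose proof (flat_ge_term k p) as H1.
  pose proof (weight_pos k); pose proof (profile_nonneg k (ell k p)); nra.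
Qed.

Lemma flat_zero_bounded (p : R * R) : flat p = 0 -> Rabs (fst p) <= 2 /\ Rabs (snd p) <= 2.
Proof.
  intros H.
  pose proof (flat_zero_inner p 0 H) as H0; pose proof (flat_zero_inner p 1 H) as H1.
  pose proof (inner_bounds 0); pose proof (inner_bounds 1).
  replace (ell 0 p) with (fst p) in H0
    by (unfold ell, dir1, dir2, param, round; simpl; field).
  replace (ell 1 p) with (snd p) in H1
    by (unfold ell, dir1, dir2, param, round; simpl; field).
  lra.
Qed.

(** Both sides are compared with [N], the weighted sum of the absolute slopes of the profiles. Each
    partial derivative is at most [N] because the directions have components in [[0, 1]]. Conversely
    [s] times the radial derivative is at least [N], all its terms being nonnegative. *)
Lemma radial_slope (y : R * R) (s : R) : 0 < s <= 1 ->
  sqrt (slope1 (ray y s) ^ 2 + slope2 (ray y s) ^ 2) <=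
  2 * (fst y * slope1 (ray y s) + snd y * slope2 (ray y s)).
Proof.
  intros Hs; set (p := ray y s).
  set (N := Series (fun k => weight k * Rabs (dprofile k (ell k p)))).
  destruct (bounded_dprofile (Rabs (fst p) + Rabs (snd p))) as [M HM].
  assert (HMk : forall k, Rabs (dprofile k (ell k p)) <= M)
    by (intros k; apply HM, ell_bound).
  assert (HN : forall b, unit_bounded b -> Rabs (ridge b dprofile p) <= N).
  { intros b Hb; unfold ridge, N.
    assert (Hle : forall k, Rabs (b k * dprofile k (ell k p)) <= Rabs (dprofile k (ell k p)))
      by (intros k; apply Rabs_mult_unit; [apply Hb | lra]).
    assert (E : forall k, Rabs (weight k * (b k * dprofile k (ell k p))) =
                weight k * Rabs (b k * dprofile k (ell k p))).
    { intros k; rewrite Rabs_mult, (Rabs_pos_eq (weight k)); auto.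
      apply Rlt_le, weight_pos. }
    apply Rle_trans with (Series (fun k => Rabs (weight k * (b k * dprofile k (ell k p))))).
    - apply Series_Rabs, (ex_series_ext (fun k => weight k * Rabs (b k * dprofile k (ell k p)))).
      + intros; symmetry; apply E.
      + apply ex_series_weighted with M; intros k; rewrite Rabs_Rabsolu.
        eapply Rle_trans; [apply Hle | apply HMk].
    - rewrite (Series_ext _ _ E); apply Series_weighted_le with M.
      + intros k; split; [apply Rabs_pos | apply Hle].
      + intros k; rewrite Rabs_Rabsolu; apply HMk. }
  assert (HD : N <= s * (fst y * slope1 p + snd y * slope2 p)).
  { replace (s * (fst y * slope1 p + snd y * slope2 p))
      with (fst p * slope1 p + snd p * slope2 p) by (unfold p, ray; simpl; ring).
    unfold slope1, slope2, ridge.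
    rewrite <- !Series_scal_l, <- Series_plus
      by (apply (ex_series_scal_l (V := R_NormedModule)), ex_series_ridge; auto with ridge).
    apply Series_le.
    - intros k; pose proof (weight_pos k); split.
      + pose proof (Rabs_pos (dprofile k (ell k p))); nra.
      + replace (fst p * (weight k * (dir1 k * dprofile k (ell k p))) +
                 snd p * (weight k * (dir2 k * dprofile k (ell k p))))
          with (weight k * (ell k p * dprofile k (ell k p))) by (unfold ell; ring).
        apply Rmult_le_compat_l; [lra|].
        (* wherever the profile has a slope, [ell k p] is at least [1] in absolute value *)
        unfold dprofile; pose proof (inner_bounds k); set (t := ell k p).
        destruct (pos_cases (t ^ 2 - inner k ^ 2)) as [[H1 ->]|[H1 H2]].
        * replace (6 * t * 0 ^ 2) with 0 by ring; rewrite Rabs_R0; lra.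
        * set (z := pos _) in *.
          assert (1 <= Rabs t).
          { rewrite <- Rabs_R1; apply Rsqr_le_abs_0; unfold Rsqr; nra. }
          rewrite !Rabs_mult, (Rabs_pos_eq 6), (Rabs_pos_eq (z ^ 2))
            by (try apply pow2_ge_0; lra).
          replace (t * (6 * t * z ^ 2)) with (6 * t ^ 2 * z ^ 2) by ring.
          rewrite <- (pow2_abs t).
          apply Rmult_le_compat_r; [apply pow2_ge_0 | nra].
    - apply (ex_series_plus (V := R_NormedModule));
        apply (ex_series_scal_l (V := R_NormedModule)), ex_series_ridge; auto with ridge. }
  pose proof (HN dir1 unit_bounded_dir1) as H1; pose proof (HN dir2 unit_bounded_dir2) as H2.
  fold (slope1 p) in H1; fold (slope2 p) in H2.
  pose proof (Rabs_pos (slope1 p)).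
  (* The Euclidean norm is at most [sqrt 2 * N], rounded up to [2 * N]; then [s <= 1] removes the
     factor [s]. *)
  apply Rle_trans with (2 * N); [|nra].
  apply Rsqr_incr_0_var; [|lra].
  rewrite Rsqr_sqrt by (apply Rplus_le_le_0_compat; apply pow2_ge_0).
  rewrite <- (pow2_abs (slope1 p)), <- (pow2_abs (slope2 p)); unfold Rsqr.
  pose proof (Rabs_pos (slope2 p)); nra.
Qed.

(** * Compactness of the set of minimizers *)

(** Heine-Borel by a gauge on the square: a point of [S] gets a ball inside a member of the cover,
    any other point a ball missing [S]. A finite family of such balls covers the square, and those
    centred outside [S] are discarded. *)
Lemma compact2_closed_bounded (S : R * R -> Prop) (B : R) :
  (forall p, ~ S p -> locally p (fun q => ~ S q)) ->
  (forall p, S p -> Rabs (fst p) <= B /\ Rabs (snd p) <= B) ->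
  compact2 S.
Proof.
  intros Hc Hb I U HU Hcov.
  assert (Hnb : forall p, exists d : posreal,
            (S p -> exists i, forall q, ball p d q -> U i q) /\
            (~ S p -> forall q, ball p d q -> ~ S q)).
  { intros p; destruct (classic (S p)) as [Hp|Hp].
    - destruct (Hcov p Hp) as [i Hi]; destruct (HU i p Hi) as [d Hd].
      exists d; split; [|tauto]; intros _; now exists i.
    - destruct (Hc p Hp) as [d Hd]; exists d; split; [tauto|]; intros _; exact Hd. }
  set (delta := fun p => proj1_sig (constructive_indefinite_description _ (Hnb p))).
  assert (Hdelta : forall p,
            (S p -> exists i, forall q, ball p (delta p) q -> U i q) /\
            (~ S p -> forall q, ball p (delta p) q -> ~ S q))
    by (intros p; exact (proj2_sig (constructive_indefinite_description _ (Hnb p)))).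
  (* [compactness_list] concludes under a double negation and encodes points of the plane as nested
     pairs ending in [tt]. *)
  destruct (NNPP _ (compactness_list 2 (- B, (- B, tt)) (B, (B, tt))
    (fun x => delta (fst x, fst (snd x))))) as [l Hl].
  assert (Hli : exists li : list I, forall x q, In x l -> S q ->
      ball (fst x, fst (snd x)) (delta (fst x, fst (snd x))) q ->
      exists i, In i li /\ U i q).
  { clear Hl; induction l as [|x l [li IH]]; [exists nil; intros x q []|].
    destruct (Hdelta (fst x, fst (snd x))) as [D1 D2].
    destruct (classic (S (fst x, fst (snd x)))) as [Hx|Hx].
    - destruct (D1 Hx) as [i Hi]; exists (i :: li); intros x' q [<-|Hin] Hq Hball.
      + exists i; split; [now left | now apply Hi].
      + destruct (IH x' q Hin Hq Hball) as (i' & ? & ?); exists i'; split; [now right | auto].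
    - exists li; intros x' q [<-|Hin] Hq Hball.
      + exfalso; now apply (D2 Hx q).
      + now apply (IH x'). }
  destruct Hli as [li Hli]; exists li; intros [p1 p2] Hp.
  destruct (Hb _ Hp) as [H1 H2]; simpl in H1, H2.
  apply Rabs_le_between in H1, H2.
  destruct (Hl (p1, (p2, tt))) as (x & Hin & _ & Hx); [simpl; tauto|].
  apply (Hli x); auto.
  destruct x as (x1 & x2 & []); simpl in Hx; destruct Hx as (Hx1 & Hx2 & _).
  split; [exact Hx1 | exact Hx2].
Qed.

Lemma compact_flat : compact2 (fun p => flat p = 0).
Proof.
  apply compact2_closed_bounded with 2; [|apply flat_zero_bounded].
  intros p Hp.
  assert (Hpos : 0 < flat p) by (pose proof (flat_nonneg p); lra).
  destruct C2_flat as ((Hcont & _) & _); pose proof (Hcont p) as Hc.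
  pose proof (proj1 (filterlim_locally _ _) Hc (mkposreal _ Hpos)) as H.
  refine (filter_imp _ _ _ H); intros q Hq E.
  change (Rabs (flat q - flat p) < flat p) in Hq.
  rewrite E, Rminus_0_l, Rabs_Ropp, Rabs_pos_eq in Hq; lra.
Qed.

(** * Failure of the inequality *)

(** Convexity between the origin, where [flat] vanishes, and [ray y t]. *)
Lemma flat_ray_mono (y : R * R) (s t : R) :
  0 <= s <= t -> 0 < t -> flat (ray y s) <= flat (ray y t).
Proof.
  intros Hst Ht.
  assert (Hl : 0 <= s / t <= 1).
  { split; [apply Rdiv_le_0_compat; lra|].
    apply (Rmult_le_reg_r t); [lra|]; unfold Rdiv; rewrite Rmult_assoc, Rinv_l; lra. }
  pose proof (flat_convex (ray y t) (0, 0) (s / t) Hl) as H; simpl in H.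
  rewrite (flat_zero_near_origin (0, 0)) in H by (simpl; rewrite Rabs_R0; lra).
  replace (s / t * (t * fst y) + (1 - s / t) * 0) with (s * fst y) in H by (field; lra).
  replace (s / t * (t * snd y) + (1 - s / t) * 0) with (s * snd y) in H by (field; lra).
  change (flat (ray y s) <= s / t * flat (ray y t) + (1 - s / t) * 0) in H.
  pose proof (flat_nonneg (ray y t)); nra.
Qed.

Lemma grad_norm_comp_flat (phi : R -> R) (p : R * R) :
  ex_derive phi (flat p) -> 0 < Derive phi (flat p) ->
  grad_norm (fun q => phi (flat q)) p =
  Derive phi (flat p) * sqrt (slope1 p ^ 2 + slope2 p ^ 2).
Proof.
  intros He Hpos; unfold grad_norm.
  assert (E1 : pd1 (fun q => phi (flat q)) p = slope1 p * Derive phi (flat p)).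
  { apply is_derive_unique, (is_derive_comp phi (fun t => flat (t, snd p))).
    - rewrite <- surjective_pairing; now apply Derive_correct.
    - apply is_derive_flat_1. }
  assert (E2 : pd2 (fun q => phi (flat q)) p = slope2 p * Derive phi (flat p)).
  { apply is_derive_unique, (is_derive_comp phi (fun t => flat (fst p, t))).
    - rewrite <- surjective_pairing; now apply Derive_correct.
    - apply is_derive_flat_2. }
  rewrite E1, E2, !Rpow_mult_distr, <- Rmult_plus_distr_r, sqrt_mult_alt
    by (apply Rplus_le_le_0_compat; apply pow2_ge_0).
  rewrite sqrt_pow2 by lra; ring.
Qed.

(** Along the ray, [phi] composed with [flat] has derivative at least half of its gradient norm by
    [radial_slope], hence at least [c / 2]; the mean value theorem integrates this. *)
Lemma KL_growth_on_ray (r c s0 : R) (phi : R -> R) (y : R * R) :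
  Kclass r phi ->
  (forall p, 0 < flat p < r -> c <= grad_norm (fun q => phi (flat q)) p) ->
  0 < s0 < 1 -> 0 < flat (ray y s0) -> flat (ray y 1) < r ->
  c / 2 * (1 - s0) <= phi (flat (ray y 1)) - phi (flat (ray y s0)).
Proof.
  intros (_ & Hex & _ & _ & Hpos) Hc Hs Hlow Hup.
  assert (Hin : forall s, s0 <= s <= 1 -> 0 < flat (ray y s) < r).
  { intros s Hs'; pose proof (flat_ray_mono y s0 s); pose proof (flat_ray_mono y s 1); lra. }
  set (d := fun s => (fst y * slope1 (ray y s) + snd y * slope2 (ray y s))
                     * Derive phi (flat (ray y s))).
  assert (Hd : forall s, s0 <= s <= 1 -> is_derive (fun s => phi (flat (ray y s))) s (d s)).
  { intros s Hs'; apply (is_derive_comp phi (fun s => flat (ray y s))).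
    - apply Derive_correct, Hex, Hin, Hs'.
    - apply is_derive_flat_ray. }
  destruct (MVT_gen (fun s => phi (flat (ray y s))) s0 1 d) as (s & Hs' & E).
  - rewrite Rmin_left, Rmax_right by lra; intros x Hx; apply Hd; lra.
  - rewrite Rmin_left, Rmax_right by lra; intros x Hx.
    apply continuity_pt_filterlim, (ex_derive_continuous (fun s => phi (flat (ray y s)))).
    eexists; now apply Hd.
  - rewrite Rmin_left, Rmax_right in Hs' by lra.
    rewrite E; apply Rmult_le_compat_r; [lra|]; unfold d.
    pose proof (Hin s Hs') as Hr.
    pose proof (Hc _ Hr) as H; rewrite grad_norm_comp_flat in H by auto.
    assert (Hs1 : 0 < s <= 1) by lra.
    pose proof (radial_slope y s Hs1) as H2; pose proof (Hpos _ Hr) as H3; nra.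
Qed.

(** * Monotonicity and sign of desingularising functions *)

Lemma Kclass_mono (r s t : R) (phi : R -> R) :
  Kclass r phi -> 0 < s <= t -> t < r -> phi s <= phi t.
Proof.
  intros (_ & Hex & _ & _ & Hpos) Hst Ht.
  destruct (MVT_gen phi s t (Derive phi)) as (x & Hx & E).
  - rewrite Rmin_left, Rmax_right by lra; intros x Hx; apply Derive_correct, Hex; lra.
  - rewrite Rmin_left, Rmax_right by lra; intros x Hx.
    apply continuity_pt_filterlim, (ex_derive_continuous phi), Hex; lra.
  - rewrite Rmin_left, Rmax_right in Hx by lra.
    assert (0 < Derive phi x) by (apply Hpos; lra); nra.
Qed.

Lemma Kclass_nonneg (r s : R) (phi : R -> R) : Kclass r phi -> 0 < s < r -> 0 <= phi s.
Proof.
  intros HK Hs; destruct (Rle_or_lt 0 (phi s)) as [|Hneg]; [assumption|exfalso].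
  destruct HK as (Hcont & HK').
  assert (H0 : 0 <= 0 < r) by lra.
  assert (Heps : 0 < - phi s) by lra.
  pose proof (proj1 (filterlim_locally _ _) (Hcont 0 H0) (mkposreal _ Heps)) as [d Hd].
  pose proof (cond_pos d).
  (* A point below [s] and so close to [0] that continuity there forces [|phi t| < - phi s], while
     monotonicity gives [phi t <= phi s < 0]. *)
  set (t := Rmin (d / 2) s).
  assert (Ht : 0 < t <= s /\ t < d).
  { unfold t; pose proof (Rmin_l (d / 2) s); pose proof (Rmin_r (d / 2) s).
    assert (0 < Rmin (d / 2) s) by (apply Rmin_pos; lra); lra. }
  assert (Hball : ball 0 d t).
  { change (Rabs (t - 0) < d); rewrite Rminus_0_r, Rabs_pos_eq; lra. }
  assert (Htr : 0 <= t < r) by lra.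
  specialize (Hd t Hball Htr).
  change (Rabs (phi t - phi 0) < - phi s) in Hd.
  assert (E : phi 0 = 0) by apply HK'.
  rewrite E, Rminus_0_r in Hd.
  assert (phi t <= phi s) by (apply (Kclass_mono r); [split; auto | lra | lra]).
  rewrite Rabs_left in Hd; lra.
Qed.

(* On the ray through [tip k], the points between parameters [notch k] and [1] lie in
   the outer half of the cap removed by strip [k]. *)
Definition tip (k : nat) : R * R := (outer k * dir1 k, outer k * dir2 k).
Definition notch (k : nat) : R := (outer k + inner k) / (2 * outer k).

Lemma notch_bounds (k : nat) : 0 < notch k < 1 /\ / (12 * (INR k + 1)) <= 1 - notch k.
Proof.
  pose proof (outer_bounds k); pose proof (inner_bounds k); pose proof (gap_lower k) as Hg.
  pose proof (pos_INR k).
  assert (Hk : 0 < / (4 * (INR k + 1))) by (apply Rinv_0_lt_compat; lra).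
  assert (E : 1 - notch k = (outer k - inner k) / (2 * outer k))
    by (unfold notch; field; lra).
  (* [2 * outer k <= 3]; with [gap_lower] this gives the constant [12 = 3 * 4]. *)
  assert (Hthird : (outer k - inner k) / 3 <= 1 - notch k).
  { rewrite E; apply Rmult_le_compat_l; [lra|]; apply Rinv_le_contravar; lra. }
  replace (/ (12 * (INR k + 1))) with (/ (4 * (INR k + 1)) / 3) by (field; lra).
  assert (0 < notch k) by (apply Rdiv_lt_0_compat; lra).
  lra.
Qed.

Lemma ell_ray (k : nat) (y : R * R) (s : R) : ell k (ray y s) = s * ell k y.
Proof. unfold ell, ray; simpl; ring. Qed.

Lemma ell_tip (j k : nat) :
  ell j (tip k) = outer k * (dir1 j * dir1 k + dir2 j * dir2 k).
Proof. unfold ell, tip; simpl; ring. Qed.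

Lemma ray_1 (y : R * R) : ray y 1 = y.
Proof. destruct y; unfold ray; simpl; f_equal; ring. Qed.

(** The [k]-th term alone suffices. There [ell k] is the midpoint [m] of [inner k] and [outer k],
    and [m^2 - inner k ^ 2] is at least the full gap, because [m - inner k] is half of it and
    [m + inner k > 2]. *)
Lemma flat_notch_lower (k : nat) :
  weight k * / (64 * (INR k + 1) ^ 3) <= flat (ray (tip k) (notch k)).
Proof.
  eapply Rle_trans; [|apply flat_ge_term with (k := k)].
  apply Rmult_le_compat_l; [apply Rlt_le, weight_pos|].
  pose proof (outer_bounds k); pose proof (inner_bounds k); pose proof (gap_lower k) as Hg.
  pose proof (pos_INR k).
  assert (Hk : 0 < / (4 * (INR k + 1))) by (apply Rinv_0_lt_compat; lra).
  assert (E : ell k (ray (tip k) (notch k)) = (outer k + inner k) / 2).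
  { rewrite ell_ray, ell_tip.
    replace (dir1 k * dir1 k + dir2 k * dir2 k) with (dir1 k ^ 2 + dir2 k ^ 2) by ring.
    rewrite dir_unit; unfold notch; field; lra. }
  unfold profile; rewrite E.
  replace (/ (64 * (INR k + 1) ^ 3)) with ((/ (4 * (INR k + 1))) ^ 3) by (field; lra).
  apply pow_incr; split; [lra|].
  eapply Rle_trans; [|apply Rmax_r]; nra.
Qed.

(** By [outer_inside] the terms before [k] vanish at the tip. The others have profile at most
    [(9/4)^3 < 12], and the tail estimate doubles this. *)
Lemma flat_tip_upper (k : nat) : flat (tip k) <= 24 * weight k.
Proof.
  assert (Hell : forall j, 0 <= ell j (tip k) <= 3 / 2).
  { intros j; rewrite ell_tip; pose proof (outer_bounds k).
    destruct (dir_bounds j), (dir_bounds k).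
    pose proof (dir_separated j k); pose proof (pow2_ge_0 (param j - param k)).
    assert (0 <= dir1 j * dir1 k + dir2 j * dir2 k) by nra; nra. }
  replace (24 * weight k) with (2 * 12 * weight k) by ring.
  apply (Series_weighted_tail (fun j => 1 * profile j (ell j (tip k)))).
  - intros j; pose proof (profile_nonneg j (ell j (tip k))); split; [lra|].
    assert (Ha : Rabs (ell j (tip k)) <= 3 / 2) by (rewrite Rabs_pos_eq; apply Hell).
    destruct (pos_inner_bound j _ _ Ha) as [_ Hp].
    unfold profile; pose proof (pow_incr _ _ 3 Hp); lra.
  - intros j Hj; rewrite (proj2 (profile_eq_0 _ _)); [ring|].
    rewrite Rabs_pos_eq by apply Hell; rewrite ell_tip; now apply outer_inside.
Qed.

Lemma flat_notch_pos (k : nat) : 0 < flat (ray (tip k) (notch k)).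
Proof.
  eapply Rlt_le_trans; [|apply flat_notch_lower].
  pose proof (weight_factor k); apply Rmult_lt_0_compat; [apply weight_pos|].
  apply Rinv_0_lt_compat; lra.
Qed.

(** This makes the value intervals of successive cuts disjoint up to endpoints. The cube in the
    weight ratio matches the cubed gap in [flat_notch_lower]. *)
Lemma flat_tip_le_notch (k : nat) : flat (tip (S k)) <= flat (ray (tip k) (notch k)).
Proof.
  eapply Rle_trans; [apply flat_tip_upper|].
  eapply Rle_trans; [|apply flat_notch_lower].
  pose proof (weight_factor k) as Hf; pose proof (weight_pos k) as Hw.
  change (weight (S k)) with (weight k / (2000 * (INR k + 1) ^ 3)).
  revert Hf; generalize ((INR k + 1) ^ 3); intros z Hz.
  replace (24 * (weight k / (2000 * z))) with (24 / 2000 * (weight k / z)) by (field; lra).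
  replace (weight k * / (64 * z)) with (/ 64 * (weight k / z)) by (field; lra).
  assert (0 < weight k / z) by (apply Rdiv_lt_0_compat; lra); lra.
Qed.

Lemma flat_tip_pos (k : nat) : 0 < flat (tip k).
Proof.
  pose proof (notch_bounds k) as [H _]; pose proof (flat_notch_pos k).
  rewrite <- (ray_1 (tip k)); pose proof (flat_ray_mono (tip k) (notch k) 1); lra.
Qed.

Lemma flat_tip_small (r : R) : 0 < r -> exists K, forall k, (K <= k)%nat -> flat (tip k) < r.
Proof.
  intros Hr.
  destruct (pow_lt_1_zero (/ 2)) with (y := r / 24) as [K HK].
  - rewrite Rabs_pos_eq; lra.
  - lra.
  - exists K; intros k Hk; specialize (HK k Hk).
    pose proof (weight_geom 0 k) as H; simpl in H.
    pose proof (flat_tip_upper k); pose proof (Rle_abs ((/ 2) ^ k)); lra.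
Qed.

(** Logarithmic increments telescope, so they stand in for the harmonic series. *)
Lemma ln_step (x : R) : 0 < x -> ln (x + 1) - ln x <= / x.
Proof.
  intros Hx; rewrite <- ln_div by lra.
  rewrite <- (ln_exp (/ x)); apply Rcomplements.ln_le.
  - apply Rdiv_lt_0_compat; lra.
  - replace ((x + 1) / x) with (1 + / x) by (field; lra).
    left; apply exp_ineq1; pose proof (Rinv_0_lt_compat x Hx); lra.
Qed.

(** From one tip to the next, [phi] of the value drops by at least [c / 24] times a logarithmic
    increment. The drops add up to an unbounded total, although [phi] is nonnegative. *)
Lemma KL_fails (r c : R) (phi : R -> R) :
  0 < r -> Kclass r phi -> 0 < c ->
  (forall p, 0 < flat p < r -> c <= grad_norm (fun q => phi (flat q)) p) -> False.
Proof.
  intros Hr HK Hc Hgrad.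
  destruct (flat_tip_small r Hr) as [K HKr].
  set (W := fun k => phi (flat (tip (K + k)))).
  set (L := fun k => ln (INR (K + k) + 1)).
  (* The factor [24] is [2 * 12]: [2] from the growth along the ray, [12] from the length of its
     outer segment. *)
  assert (Hstep : forall k, W (S k) + c / 24 * (L (S k) - L k) <= W k).
  { intros k; unfold W, L; rewrite Nat.add_succ_r; set (j := (K + k)%nat).
    pose proof (notch_bounds j) as [Hn Hd]; pose proof (pos_INR j) as Hj.
    pose proof (flat_notch_pos j).
    assert (Hjr : flat (ray (tip j) 1) < r) by (rewrite ray_1; apply HKr; lia).
    pose proof (KL_growth_on_ray r c (notch j) phi (tip j) HK Hgrad Hn
      (flat_notch_pos j) Hjr) as Hgrow.
    pose proof (flat_ray_mono (tip j) (notch j) 1) as Hm.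
    assert (phi (flat (tip (S j))) <= phi (flat (ray (tip j) (notch j)))).
    { apply (Kclass_mono r); auto; [|lra].
      split; [apply flat_tip_pos | apply flat_tip_le_notch]. }
    rewrite ray_1 in Hgrow.
    rewrite S_INR; pose proof (ln_step (INR j + 1)) as Hln.
    replace (/ (12 * (INR j + 1))) with (/ (INR j + 1) / 12) in Hd by (field; lra).
    assert (c / 2 * (/ (INR j + 1) / 12) <= c / 2 * (1 - notch j))
      by (apply Rmult_le_compat_l; lra).
    assert (c / 24 * (ln (INR j + 1 + 1) - ln (INR j + 1)) <= c / 24 * / (INR j + 1))
      by (apply Rmult_le_compat_l; lra).
    lra. }
  assert (Hsum : forall k, W k + c / 24 * (L k - L 0%nat) <= W 0%nat).
  { induction k as [|k IH]; [lra|]; specialize (Hstep k); lra. }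
  assert (HW : forall k, 0 <= W k).
  { intros k; apply (Kclass_nonneg r); auto; split; [apply flat_tip_pos | apply HKr; lia]. }
  (* Once [L k] exceeds [Y], the bound [Hsum] makes [W k] negative. *)
  set (Y := L 0%nat + W 0%nat / (c / 24)).
  destruct (INR_unbounded (exp Y)) as [k Hk].
  assert (HL : Y < L k).
  { rewrite <- (ln_exp Y); apply ln_increasing; [apply exp_pos|].
    rewrite plus_INR; pose proof (pos_INR K); lra. }
  specialize (Hsum k); specialize (HW k).
  assert (c / 24 * (Y - L 0%nat) = W 0%nat) by (unfold Y; field; lra).
  assert (c / 24 * (Y - L 0%nat) < c / 24 * (L k - L 0%nat))
    by (apply Rmult_lt_compat_l; lra).
  lra.
Qed.

Theorem theorem4p11 :
  exists f : R * R -> R,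
    C2_2d f /\ convex2 f /\
    (* min f = 0 *)
    (forall p, 0 <= f p) /\ (exists p, f p = 0) /\
    (* the set of minimizers is compact with nonempty interior *)
    compact2 (fun p => f p = 0) /\
    (exists p, locally p (fun q => f q = 0)) /\
    (* failure of the KL inequality *)
    (forall (r : R) (phi : R -> R), 0 < r -> Kclass r phi ->
       Glb_Rbar (fun v => exists p, 0 < f p < r /\
                           v = grad_norm (fun q => phi (f q)) p) = Finite 0).
Proof.
  exists flat; split; [exact C2_flat|]; split; [exact flat_convex|].
  split; [exact flat_nonneg|]; split; [|split; [exact compact_flat|split]].
  - exists (0, 0); apply flat_zero_near_origin; simpl; rewrite Rabs_R0; lra.
  - exists (0, 0), (mkposreal (/ 2) ltac:(lra)); intros [q1 q2] [H1 H2].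
    change (Rabs (q1 - 0) < / 2) in H1; change (Rabs (q2 - 0) < / 2) in H2.
    rewrite Rminus_0_r in H1, H2.
    apply flat_zero_near_origin; simpl; lra.
  - intros r phi Hr HK; apply is_glb_Rbar_unique; split.
    + intros v (p & _ & ->); apply sqrt_pos.
    + intros b Hb; destruct (Rbar_le_lt_dec b 0) as [|Hlt]; [assumption|exfalso].
      (* The lower bound [b] may be [+oo]; any finite positive [c] below it contradicts
         [KL_fails]. *)
      assert (Hc : exists c : R, 0 < c /\ Rbar_le c b).
      { destruct b as [b| |]; simpl in Hlt.
        - exists b; split; [exact Hlt | apply Rle_refl].
        - exists 1; split; [lra | exact I].
        - contradiction. }
      destruct Hc as (c & Hc & Hcb).
      apply (KL_fails r c phi); auto.
      intros p Hp.
      apply (Rbar_le_trans c b (grad_norm (fun q => phi (flat q)) p)); [exact Hcb|].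
      apply Hb; now exists p.
Qed.
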